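(* Let $k\in\{1,2\}$, put $\alpha_k(1)=\frac{5k+2}{2k+1}$ and $x_k(n)=\frac{\pi\sqrt{24n-(2k+2)}}{6}$ for integers $n\ge1$. Then for every integer $n\ge 2$ with $x_k(n)\ge152$, \[\frac{I_2^2\!\left(\sqrt{\alpha_k(1)}\,x_k(n)\right)}{I_2\!\left(\sqrt{\alpha_k(1)}\,x_k(n-1)\right)I_2\!\left(\sqrt{\alpha_k(1)}\,x_k(n+1)\right)}>1+\frac{\pi^4\sqrt{\alpha_k(1)}}{9x_k^3(n)}-\frac{1100}{x_k^4(n)},\] where $I_2$ is the modified Bessel function of the first kind of order $2$.
   Context: The modified Bessel function of the first kind is $I_\nu(s)=\sum_{r\ge0}\frac{1}{r!\,\Gamma(r+\nu+1)}(s/2)^{2r+\nu}$. *)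

(* Defs.v *)
From Stdlib Require Import Factorial Reals.
From Coquelicot Require Import Coquelicot.
Open Scope R_scope.

(* Euler's integral; it converges for 0 < x. *)
Definition Gamma (x : R) : R :=
  RInt_gen (fun t => Rpower t (x - 1) * exp (- t))
    (at_right 0) (Rbar_locally p_infty).

(* Modified Bessel function of the first kind, order nu > -1 and argument s > 0
   (the ranges on which Gamma and Rpower have their usual meaning). *)
Definition BesselI (nu s : R) : R :=
  Series (fun r : nat =>
    / (INR (fact r) * Gamma (INR r + nu + 1))
    * Rpower (s / 2) (2 * INR r + nu)).

(* The value alpha_k(1). *)
Definition alpha1 (k : nat) : R := (5 * INR k + 2) / (2 * INR k + 1).

Definition xk (k n : nat) : R :=
  PI * sqrt (24 * INR n - (2 * INR k + 2)) / 6.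

(* Main.v *)
Require Import Defs.
From Stdlib Require Import Factorial Reals Lra Lia.
From Coquelicot Require Import Coquelicot.
Open Scope R_scope.

(** Write I_2(s) = u phi(u) with u = s^2/4; then u phi'' + 3 phi' = phi.
    An integrating factor argument bounds p = phi'/phi below by
    u^(-1/2) - 5/(4u), and the Riccati equation p' = (1 - 3p)/u - p^2 turns this
    into (ln (u phi))'' <= - u^(-3/2)/2 + (19/16) u^(-2).  For alpha = alpha_k(1)
    and u = alpha x_k(n)^2/4, the arguments at n - 1 and n + 1 correspond to u - e
    and u + e with e = pi^2 alpha/6, so the logarithm of the quotient is a second
    difference of ln (u phi).  It is compared with the second differences of
    2 sqrt u, which give exactly the main term pi^4 sqrt(alpha)/(9 x^3), and of
    (19/16) ln u, which cost only O(x^(-4)). *)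

(** * The Gamma function at positive integers *)

(** Repeated integration by parts of [t ^ n * exp (- t)]. The closed form is [- exp (- t)] times n!
    times the Taylor polynomial of exp of degree n, so the constant of integration makes it vanish
    at infinity. *)
Fixpoint gamma_primitive (n : nat) (t : R) : R :=
  match n with
  | O => - exp (- t)
  | S m => INR (S m) * gamma_primitive m t - t ^ S m * exp (- t)
  end.

Lemma is_derive_gamma_primitive n t :
  is_derive (gamma_primitive n) t (t ^ n * exp (- t)).
Proof.
  induction n as [|n IH].
  - simpl; auto_derive; [trivial | ring].
  - evar_last.
    + apply (is_derive_minus (V := R_NormedModule)
               (fun t => INR (S n) * gamma_primitive n t)
               (fun t => t ^ S n * exp (- t))).
      * apply is_derive_scal, IH.
      * auto_derive; [trivial | reflexivity].
    + unfold minus, plus, opp; cbn -[INR pow].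
      change (match n with 0%nat => 1 | S _ => INR n + 1 end) with (INR (S n)).
      simpl pow; ring.
Qed.

Lemma gamma_primitive_0 n : gamma_primitive n 0 = - INR (fact n).
Proof.
  induction n as [|n IH].
  - simpl; rewrite Ropp_0, exp_0; ring.
  - cbn [gamma_primitive]; rewrite IH, fact_simpl, mult_INR, pow_i by lia; ring.
Qed.

(** The Taylor term of degree n + 1 alone bounds exp from below, which leaves at most (n+1)!/t. *)
Lemma is_lim_pow_mul_exp_opp n : is_lim (fun t => t ^ n * exp (- t)) p_infty 0.
Proof.
  apply is_lim_le_le_loc with (fun _ => 0) (fun t => INR (fact (S n)) * / t).
  - exists 1; intros t ht.
    assert (hfact := INR_fact_lt_0 (S n)).
    assert (hpow : 0 < t ^ n) by (apply pow_lt; lra).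
    split; [apply Rmult_le_pos; [lra | left; apply exp_pos] |].
    assert (htaylor : t ^ S n / INR (fact (S n)) <= exp t).
    { eapply Rle_trans; [| apply (exp_ge_taylor t (S n)); lra].
      rewrite tech5.
      assert (0 <= sum_f_R0 (fun k => t ^ k / INR (fact k)) n); [| lra].
      apply cond_pos_sum; intros k; apply Rmult_le_pos;
        [apply pow_le; lra | left; apply Rinv_0_lt_compat, INR_fact_lt_0]. }
    assert (hle : t ^ S n <= INR (fact (S n)) * exp t).
    { apply Rmult_le_reg_r with (/ INR (fact (S n))).
      - now apply Rinv_0_lt_compat.
      - replace (INR (fact (S n)) * exp t * / INR (fact (S n))) with (exp t)
          by (field; lra); exact htaylor. }
    rewrite exp_Ropp.
    apply Rmult_le_reg_r with (t * exp t).
    + apply Rmult_lt_0_compat; [lra | apply exp_pos].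
    + assert (hexp := exp_pos t).
      replace (t ^ n * / exp t * (t * exp t)) with (t ^ S n) by (simpl; field; lra).
      replace (INR (fact (S n)) * / t * (t * exp t))
        with (INR (fact (S n)) * exp t) by (field; lra).
      exact hle.
  - apply is_lim_const.
  - evar_last.
    + apply (is_lim_scal_l Rinv (INR (fact (S n))) p_infty 0).
      replace (Finite 0) with (Rbar_inv p_infty) by reflexivity.
      apply is_lim_inv; [apply is_lim_id | discriminate].
    + simpl; now rewrite Rmult_0_r.
Qed.

Lemma is_lim_gamma_primitive n : is_lim (gamma_primitive n) p_infty 0.
Proof.
  induction n as [|n IH].
  - apply is_lim_ext with (fun t => - (t ^ 0 * exp (- t))).
    + intros t; simpl; ring.
    + evar_last; [apply is_lim_opp, is_lim_pow_mul_exp_opp |].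
      simpl; now rewrite Ropp_0.
  - evar_last.
    + apply (is_lim_minus' (fun t => INR (S n) * gamma_primitive n t)
               (fun t => t ^ S n * exp (- t)) p_infty (INR (S n) * 0) 0).
      * apply (is_lim_scal_l _ _ _ (Finite 0)), IH.
      * apply is_lim_pow_mul_exp_opp.
    + f_equal; ring.
Qed.

Lemma Gamma_INR_fact n : Gamma (INR n + 1) = INR (fact n).
Proof.
  assert (hDerive : forall t, Derive (gamma_primitive n) t = t ^ n * exp (- t))
    by (intros t; apply is_derive_unique, is_derive_gamma_primitive).
  (* [Rpower] agrees with the integer power only at positive base, so both endpoints are kept
     positive. *)
  assert (hpos : filter_prod (at_right 0) (Rbar_locally p_infty)
                   (fun ab => 0 < fst ab /\ 0 < snd ab)).
  { apply Filter_prod with (fun a => 0 < a) (fun b => 0 < b); [| | now split].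
    - exists (mkposreal 1 Rlt_0_1); trivial.
    - now exists 0. }
  assert (htrue : filter_prod (at_right 0) (Rbar_locally p_infty) (fun _ => True))
    by (eapply filter_imp; [| exact hpos]; trivial).
  unfold Gamma; apply is_RInt_gen_unique.
  replace (INR (fact n)) with (0 - gamma_primitive n 0)
    by (rewrite gamma_primitive_0; ring).
  apply (is_RInt_gen_ext (Derive (gamma_primitive n))).
  - eapply filter_imp; [| exact hpos].
    intros [a b] [ha hb] x [hx _]; simpl in *.
    rewrite hDerive.
    replace (INR n + 1 - 1) with (INR n) by ring.
    rewrite Rpower_pow; [reflexivity |].
    now apply Rlt_trans with (2 := hx), Rmin_glb_lt.
  - apply is_RInt_gen_Derive.
    + eapply filter_imp; [| exact htrue]; intros ab _ x _.
      eexists; apply is_derive_gamma_primitive.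
    + eapply filter_imp; [| exact htrue]; intros ab _ x _.
      apply continuous_ext with (fun t => t ^ n * exp (- t)); [now intros |].
      apply (ex_derive_continuous (V := R_NormedModule)); auto_derive; trivial.
    (* The primitive is continuous at 0, so its limit along the coarser filter [locally 0] gives the
       one along [at_right 0]. *)
    + apply (@filterlim_filter_le_1 R R (locally 0)).
      * intros P [e he]; exists e; auto.
      * apply (ex_derive_continuous (V := R_NormedModule)).
        eexists; apply is_derive_gamma_primitive.
    + exact (is_lim_gamma_primitive n).
Qed.

(** * The power series of [I_2] *)

Definition bessel2_coef (r : nat) : R := / (INR (fact r) * INR (fact (r + 2))).

(* I_2(s) = u * bessel2_series u with u = (s / 2)^2. *)
Definition bessel2_series : R -> R := PSeries bessel2_coef.
Definition bessel2_series' : R -> R := PSeries (PS_derive bessel2_coef).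
Definition bessel2_series'' : R -> R :=
  PSeries (PS_derive (PS_derive bessel2_coef)).

Lemma bessel2_coef_pos r : 0 < bessel2_coef r.
Proof.
  apply Rinv_0_lt_compat, Rmult_lt_0_compat; apply INR_fact_lt_0.
Qed.

(** This recurrence yields both the infinite radius of convergence and the differential equation. *)
Lemma bessel2_coef_S r :
  bessel2_coef (S r) * ((INR r + 1) * (INR r + 3)) = bessel2_coef r.
Proof.
  unfold bessel2_coef.
  replace (S r + 2)%nat with (S (r + 2)) by lia.
  rewrite !fact_simpl, !mult_INR, !S_INR, plus_INR.
  assert (h := pos_INR r).
  assert (h1 := INR_fact_lt_0 r).
  assert (h2 := INR_fact_lt_0 (r + 2)).
  simpl (INR 2); field; lra.
Qed.

Lemma CV_radius_bessel2_coef : CV_radius bessel2_coef = p_infty.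
Proof.
  apply CV_radius_infinite_DAlembert.
  - intros r; apply Rgt_not_eq, bessel2_coef_pos.
  - apply is_lim_seq_le_le with (fun _ => 0) (fun r => / INR (S r)).
    + intros r.
      rewrite <- (bessel2_coef_S r).
      assert (h := pos_INR r).
      assert (hc := bessel2_coef_pos (S r)).
      replace (bessel2_coef (S r) /
               (bessel2_coef (S r) * ((INR r + 1) * (INR r + 3))))
        with (/ ((INR r + 1) * (INR r + 3))) by (field; lra).
      rewrite S_INR, Rabs_pos_eq.
      * split; [left; apply Rinv_0_lt_compat; nra | apply Rinv_le_contravar; nra].
      * left; apply Rinv_0_lt_compat; nra.
    + apply is_lim_seq_const.
    + replace (Finite 0) with (Rbar_inv p_infty) by reflexivity.
      apply is_lim_seq_inv; [| discriminate].
      apply (is_lim_seq_incr_1 INR), is_lim_seq_INR.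
Qed.

Lemma is_derive_bessel2_series u : is_derive bessel2_series u (bessel2_series' u).
Proof.
  apply is_derive_PSeries; now rewrite CV_radius_bessel2_coef.
Qed.

Lemma is_derive_bessel2_series' u : is_derive bessel2_series' u (bessel2_series'' u).
Proof.
  apply is_derive_PSeries; now rewrite CV_radius_derive, CV_radius_bessel2_coef.
Qed.

(** At degree n the left side has coefficient (n(n+1) + 3(n+1)) c_{n+1} = (n+1)(n+3) c_{n+1}, which
    the recurrence identifies with c_n. *)
Lemma bessel2_series_ode u :
  u * bessel2_series'' u + 3 * bessel2_series' u = bessel2_series u.
Proof.
  unfold bessel2_series, bessel2_series', bessel2_series''.
  rewrite <- PSeries_incr_1, <- PSeries_scal, <- PSeries_plus.
  - apply PSeries_ext; intros n.
    rewrite <- (bessel2_coef_S n).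
    unfold PS_plus, PS_scal, PS_incr_1, PS_derive, plus, scal; cbn -[INR].
    destruct n as [|n]; unfold zero, mult; cbn -[INR];
      rewrite ?S_INR, ?INR_0; ring.
  - apply ex_pseries_incr_1, CV_radius_inside.
    now rewrite !CV_radius_derive, CV_radius_bessel2_coef.
  - apply ex_pseries_scal; [apply Rmult_comm |].
    apply CV_radius_inside; now rewrite CV_radius_derive, CV_radius_bessel2_coef.
Qed.

(** The constant coefficient is positive, and the rest is u times a series with nonnegative
    terms. *)
Lemma PSeries_pos (a : nat -> R) (u : R) :
  (forall n, 0 < a n) -> CV_radius a = p_infty -> 0 <= u -> 0 < PSeries a u.
Proof.
  intros ha hr hu.
  apply Rlt_le_trans with (1 := ha 0%nat).
  rewrite PSeries_decr_1 by (apply CV_radius_inside; now rewrite hr).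
  assert (0 <= PSeries (PS_decr_1 a) u); [| nra].
  apply Rle_trans with (Series (fun _ => 0 * 0)); [rewrite Series_scal_l; lra |].
  apply Series_le.
  - intros n; rewrite Rmult_0_l; split; [lra |].
    apply Rmult_le_pos; [left; apply ha | now apply pow_le].
  - apply (ex_series_ext (fun n => scal (pow_n u n) (PS_decr_1 a n))).
    + intros n; rewrite pow_n_pow; apply Rmult_comm.
    + apply CV_radius_inside; now rewrite CV_radius_decr_1, hr.
Qed.

Lemma bessel2_series_pos u : 0 <= u -> 0 < bessel2_series u.
Proof.
  apply PSeries_pos; [exact bessel2_coef_pos | exact CV_radius_bessel2_coef].
Qed.

Lemma bessel2_series'_pos u : 0 <= u -> 0 < bessel2_series' u.
Proof.
  apply PSeries_pos.
  - intros n; apply Rmult_lt_0_compat; [apply lt_0_INR; lia | apply bessel2_coef_pos].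
  - rewrite CV_radius_derive; exact CV_radius_bessel2_coef.
Qed.

Lemma BesselI_2_series s :
  0 < s -> BesselI 2 s = (s / 2) ^ 2 * bessel2_series ((s / 2) ^ 2).
Proof.
  intros hs.
  unfold BesselI, bessel2_series, PSeries.
  rewrite <- Series_scal_l.
  apply Series_ext; intros r.
  replace (INR r + 2 + 1) with (INR (r + 2) + 1)
    by (rewrite plus_INR; simpl; ring).
  replace (2 * INR r + 2) with (INR (2 + 2 * r))
    by (rewrite plus_INR, mult_INR; simpl; ring).
  rewrite Gamma_INR_fact, Rpower_pow, pow_add, pow_mult by lra.
  unfold bessel2_coef; ring.
Qed.

(** * The logarithmic derivative of [I_2] *)

(* With psi s = bessel2_series (s^2 / 4) and N = psi' + (5 / (2 s) - 1) psi,
   the equation psi'' + (5 / s) psi' = psi gives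
   (e^s s^(5/2) N)' = e^s s^(5/2) * 15 / (4 s^2) * psi > 0,
   while N > 0 is clear for s <= 5/2. *)
Lemma bessel2_series'_lower s : 0 < s ->
  (1 - 5 / (2 * s)) * bessel2_series (s ^ 2 / 4)
    <= s / 2 * bessel2_series' (s ^ 2 / 4).
Proof.
  intros hs.
  set (N := fun s => s / 2 * bessel2_series' (s ^ 2 / 4)
                     + (5 / (2 * s) - 1) * bessel2_series (s ^ 2 / 4)).
  assert (hsmall : forall s, 0 < s <= 5 / 2 -> 0 < N s).
  { intros t ht; unfold N.
    assert (h := bessel2_series_pos (t ^ 2 / 4) ltac:(nra)).
    assert (h' := bessel2_series'_pos (t ^ 2 / 4) ltac:(nra)).
    assert (5 / (2 * t) >= 1).
    { apply Rle_ge, Rmult_le_reg_r with t; [lra |].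
      replace (5 / (2 * t) * t) with (5 / 2) by (field; lra); lra. }
    assert (0 < t / 2 * bessel2_series' (t ^ 2 / 4)) by (apply Rmult_lt_0_compat; lra).
    nra. }
  enough (0 <= N s) by (unfold N in *; lra).
  destruct (Rle_lt_dec s (5 / 2)) as [hle | hgt]; [left; apply hsmall; lra |].
  (* The integrating factor e^s s^(5/2), written as one exponential so that it is visibly
     positive. *)
  set (w := fun s => exp (s + 5 / 2 * ln s)).
  assert (hw : forall s, 0 < w s) by (intros; apply exp_pos).
  destruct (MVT_cor2 (fun s => w s * N s)
              (fun s => w s * (15 / (4 * s ^ 2) * bessel2_series (s ^ 2 / 4)))
              (5 / 2) s hgt) as [c [hc hcs]].
  - intros t ht; apply is_derive_Reals; unfold w, N; auto_derive.
    + repeat split; try lra; eexists;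
        [apply is_derive_bessel2_series' | apply is_derive_bessel2_series].
    + rewrite (is_derive_unique _ _ _ (is_derive_bessel2_series _)).
      rewrite (is_derive_unique _ _ _ (is_derive_bessel2_series' _)).
      replace (t * (t * 1)) with (t ^ 2) by ring; fold (t ^ 2 / 4).
      rewrite <- (bessel2_series_ode (t ^ 2 / 4)).
      field; lra.
  - assert (0 < w c * (15 / (4 * c ^ 2) * bessel2_series (c ^ 2 / 4))).
    { apply Rmult_lt_0_compat; [apply hw |].
      apply Rmult_lt_0_compat; [apply Rdiv_lt_0_compat; nra |].
      apply bessel2_series_pos; nra. }
    assert (h0 : 0 < w (5 / 2) * N (5 / 2))
      by (apply Rmult_lt_0_compat; [apply hw | apply hsmall; lra]).
    assert (hs' := hw s).
    assert (0 < w s * N s) by nra.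
    nra.
Qed.

(** The preceding bound at s = 2 sqrt u, divided by [sqrt u * bessel2_series u]. *)
Lemma bessel2_log_derivative_lower u : 0 < u ->
  / sqrt u - 5 / (4 * u) <= bessel2_series' u / bessel2_series u.
Proof.
  intros hu.
  assert (ha := sqrt_lt_R0 u hu).
  assert (haa := sqrt_sqrt u (Rlt_le _ _ hu)).
  set (a := sqrt u) in *.
  assert (h := bessel2_series'_lower (2 * a) ltac:(lra)).
  replace ((2 * a) ^ 2 / 4) with u in h by (rewrite <- haa; field).
  assert (hpos := bessel2_series_pos u (Rlt_le _ _ hu)).
  apply Rmult_le_reg_r with (a * bessel2_series u); [nra |].
  replace (bessel2_series' u / bessel2_series u * (a * bessel2_series u))
    with (2 * a / 2 * bessel2_series' u) by (field; lra).
  eapply Rle_trans; [| exact h].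
  right; rewrite <- haa; field; lra.
Qed.

(** * Second differences and the lower bound for the quotient *)

(** The mean value theorem on each half turns the second difference into e (f'(c) - f'(d)) with d <
    u < c; a third application, to f', gives the sign. *)
Lemma second_difference_nonpos (f df d2f : R -> R) (u e : R) :
  0 < e ->
  (forall v, u - e <= v <= u + e -> is_derive f v (df v)) ->
  (forall v, u - e <= v <= u + e -> is_derive df v (d2f v)) ->
  (forall v, u - e <= v <= u + e -> d2f v <= 0) ->
  f (u + e) + f (u - e) <= 2 * f u.
Proof.
  intros he hf hdf hneg.
  destruct (MVT_cor2 f df u (u + e)) as [c [hc hcu]]; [lra | |].
  { intros v hv; apply is_derive_Reals, hf; lra. }
  destruct (MVT_cor2 f df (u - e) u) as [d [hd hdu]]; [lra | |].
  { intros v hv; apply is_derive_Reals, hf; lra. }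
  destruct (MVT_cor2 df d2f d c) as [z [hz hzu]]; [lra | |].
  { intros v hv; apply is_derive_Reals, hdf; lra. }
  assert (d2f z <= 0) by (apply hneg; lra).
  assert (df c <= df d) by nra.
  nra.
Qed.

(* [ln (u * bessel2_series u) - (2 sqrt u - 19/16 ln u)] is concave. *)
Lemma bessel2_log_second_difference u e :
  0 < e -> 25 / 16 <= u - e ->
  let L v := 35 / 16 * ln v + ln (bessel2_series v) - 2 * sqrt v in
  L (u + e) + L (u - e) <= 2 * L u.
Proof.
  intros he hu L.
  apply second_difference_nonpos with
    (df := fun v => 35 / 16 * / v + bessel2_series' v / bessel2_series v - / sqrt v)
    (d2f := fun v => - (35 / 16) / v ^ 2
                     + bessel2_series'' v / bessel2_series v
                     - (bessel2_series' v / bessel2_series v) ^ 2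
                     + / (2 * v * sqrt v)); [assumption | | |];
    intros v hv;
    assert (hpos := bessel2_series_pos v ltac:(lra));
    assert (ha := sqrt_lt_R0 v ltac:(lra));
    assert (haa := sqrt_sqrt v ltac:(lra)).
  - unfold L; auto_derive.
    + repeat split; try lra; eexists; apply is_derive_bessel2_series.
    + rewrite (is_derive_unique _ _ _ (is_derive_bessel2_series _)).
      field; lra.
  - auto_derive.
    + repeat split; try lra; eexists;
        [apply is_derive_bessel2_series' | apply is_derive_bessel2_series].
    + rewrite (is_derive_unique _ _ _ (is_derive_bessel2_series _)).
      rewrite (is_derive_unique _ _ _ (is_derive_bessel2_series' _)).
      set (a := sqrt v) in *; clearbody a; subst v; field; lra.
  - assert (hp := bessel2_log_derivative_lower v ltac:(lra)).
    assert (hode : bessel2_series'' v / bessel2_series v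
                   = (1 - 3 * (bessel2_series' v / bessel2_series v)) / v).
    { assert (h := bessel2_series_ode v).
      replace (bessel2_series'' v)
        with ((bessel2_series v - 3 * bessel2_series' v) / v)
        by (rewrite <- h; field; lra).
      field; lra. }
    rewrite hode.
    set (p := bessel2_series' v / bessel2_series v) in *.
    set (a := sqrt v) in *.
    set (p0 := / a - 5 / (4 * v)) in *.
    (* Here v >= 25/16 enters, as sqrt v >= 5/4. Nonnegativity of [p0] is what allows squaring
       [p0 <= p] below. *)
    assert (hp0 : 0 <= p0).
    { replace p0 with ((4 * a - 5) / (4 * v))
        by (unfold p0; rewrite <- haa; field; lra).
      apply Rdiv_le_0_compat; nra. }
    assert (hv' : 0 < / v) by (apply Rinv_0_lt_compat; lra).
    assert (h1 : (1 - 3 * p) / v <= (1 - 3 * p0) / v)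
      by (apply Rmult_le_compat_r; lra).
    assert (h2 : p0 ^ 2 <= p ^ 2) by (apply pow_incr; lra).
    (* The constant 35/16 = 1 + 19/16 is the one for which replacing p by [p0] gives exactly zero;
       the 1 comes from the factor u in front of the series. *)
    assert (h3 : - (35 / 16) / v ^ 2 + (1 - 3 * p0) / v - p0 ^ 2
                 + / (2 * v * a) = 0)
      by (unfold p0; rewrite <- haa; field; lra).
    lra.
Qed.

(** With z = e/u, the product bc of the outer roots is u sqrt(1 - z^2) <= u (1 - z^2/2). Hence (b +
    c)^2 = 2u + 2bc <= u (4 - z^2) <= u (2 - z^2/4)^2. *)
Lemma sqrt_second_difference u e : 0 < e < u ->
  e ^ 2 / (4 * (u * sqrt u)) <= 2 * sqrt u - sqrt (u + e) - sqrt (u - e).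
Proof.
  intros he.
  assert (ha := sqrt_lt_R0 u ltac:(lra)).
  assert (haa := sqrt_sqrt u ltac:(lra)).
  assert (hb := sqrt_lt_R0 (u + e) ltac:(lra)).
  assert (hbb := sqrt_sqrt (u + e) ltac:(lra)).
  assert (hc := sqrt_lt_R0 (u - e) ltac:(lra)).
  assert (hcc := sqrt_sqrt (u - e) ltac:(lra)).
  set (a := sqrt u) in *; set (b := sqrt (u + e)) in *; set (c := sqrt (u - e)) in *.
  set (z := e / u).
  assert (hz : 0 < z < 1).
  { split; [apply Rdiv_lt_0_compat; lra |].
    apply Rmult_lt_reg_r with u; [lra |]; unfold z.
    replace (e / u * u) with e by (field; lra); lra. }
  assert (hez : e = u * z) by (unfold z; field; lra).
  replace (e ^ 2 / (4 * (u * a))) with (a * (z ^ 2 / 4))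
    by (rewrite hez, <- haa; field; lra).
  assert (hbc : b * c <= u * (1 - z ^ 2 / 2)).
  { apply Rsqr_incr_0_var; [| nra]; unfold Rsqr.
    replace (b * c * (b * c)) with ((b * b) * (c * c)) by ring.
    rewrite hbb, hcc, hez.
    assert (0 <= (u * z ^ 2) ^ 2) by apply pow2_ge_0.
    nra. }
  enough (b + c <= a * (2 - z ^ 2 / 4)) by lra.
  apply Rsqr_incr_0_var; [| apply Rmult_le_pos; nra]; unfold Rsqr.
  replace (a * (2 - z ^ 2 / 4) * (a * (2 - z ^ 2 / 4)))
    with (a * a * (4 - z ^ 2 + z ^ 4 / 16)) by field.
  assert (0 <= a * a * z ^ 4) by (apply Rmult_le_pos; [nra | apply pow_le; lra]).
  rewrite haa in *; nra.
Qed.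

Lemma ln_le_sub_one x : 0 < x -> ln x <= x - 1.
Proof.
  intros hx.
  assert (h := exp_ineq1_le (ln x)).
  rewrite exp_ln in h by assumption; lra.
Qed.

(** Since R >= 1 + ln R, it suffices to bound the logarithm of the quotient. There ln G is the
    concave function treated above plus 2 sqrt v - (19/16) ln v, and each piece has its own
    estimate. *)
Lemma bessel2_ratio_lower u e :
  0 < e -> 25 / 16 <= u - e ->
  let G v := v * bessel2_series v in
  1 + e ^ 2 / (2 * (u * sqrt u)) - 19 / 16 * (e ^ 2 / (u ^ 2 - e ^ 2))
    <= G u ^ 2 / (G (u - e) * G (u + e)).
Proof.
  intros he hu G.
  assert (hG : forall v, 0 < v -> 0 < G v /\ ln (G v) = ln v + ln (bessel2_series v)).
  { intros v hv; assert (h := bessel2_series_pos v (Rlt_le _ _ hv)).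
    unfold G; split; [nra | now apply ln_mult]. }
  destruct (hG u ltac:(lra)) as [h0 l0].
  destruct (hG (u - e) ltac:(lra)) as [hm lm].
  destruct (hG (u + e) ltac:(lra)) as [hp lp].
  assert (hmp : 0 < G (u - e) * G (u + e)) by now apply Rmult_lt_0_compat.
  assert (h02 : 0 < G u ^ 2) by now apply pow_lt.
  assert (hln : ln (G u ^ 2 / (G (u - e) * G (u + e)))
                = 2 * ln (G u) - ln (G (u - e)) - ln (G (u + e))).
  { unfold Rdiv; rewrite ln_mult, ln_Rinv, ln_mult, ln_pow;
      [simpl; ring | try assumption ..].
    now apply Rinv_0_lt_compat. }
  assert (hexp : 1 + ln (G u ^ 2 / (G (u - e) * G (u + e)))
                 <= G u ^ 2 / (G (u - e) * G (u + e))).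
  { rewrite <- (exp_ln (G u ^ 2 / _)) at 2 by now apply Rdiv_lt_0_compat.
    apply exp_ineq1_le. }
  eapply Rle_trans; [| exact hexp].
  rewrite hln, l0, lm, lp.
  assert (hL := bessel2_log_second_difference u e he hu); cbv zeta in hL.
  assert (hsqrt := sqrt_second_difference u e ltac:(lra)).
  (* The left side is ln y with y = u^2/(u^2 - e^2), and the right side is y - 1. *)
  assert (hlog : 2 * ln u - ln (u - e) - ln (u + e) <= e ^ 2 / (u ^ 2 - e ^ 2)).
  { assert (hd : 0 < u ^ 2 - e ^ 2) by nra.
    assert (h := ln_le_sub_one (u ^ 2 / (u ^ 2 - e ^ 2))
                   ltac:(apply Rdiv_lt_0_compat; nra)).
    replace (u ^ 2 / (u ^ 2 - e ^ 2) - 1) with (e ^ 2 / (u ^ 2 - e ^ 2)) in h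
      by (field; lra).
    eapply Rle_trans; [right | exact h].
    replace (u ^ 2 - e ^ 2) with ((u - e) * (u + e)) by ring.
    unfold Rdiv; rewrite ln_mult, ln_Rinv, ln_mult, ln_pow; simpl; try nra.
    apply Rinv_0_lt_compat; nra. }
  replace (e ^ 2 / (2 * (u * sqrt u))) with (2 * (e ^ 2 / (4 * (u * sqrt u)))).
  - lra.
  - assert (0 < sqrt u) by (apply sqrt_lt_R0; lra).
    field; lra.
Qed.

(** * Specialization to the arguments x_k(n) *)

(** The square is affine in n with slope 2 pi^2/3; multiplied by alpha/4, this is the step e = pi^2
    alpha/6. *)
Lemma xk_sqr k n : 2 * INR k + 2 <= 24 * INR n ->
  xk k n ^ 2 = PI ^ 2 * (24 * INR n - (2 * INR k + 2)) / 36.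
Proof.
  intros h; unfold xk.
  assert (hs := pow2_sqrt (24 * INR n - (2 * INR k + 2)) ltac:(lra)).
  rewrite <- hs at 2; field.
Qed.

Theorem theorem3p2 (k : nat) (hk : k = 1%nat \/ k = 2%nat)
    (n : nat) (hn : (2 <= n)%nat) (hx : 152 <= xk k n) :
  (BesselI 2 (sqrt (alpha1 k) * xk k n)) ^ 2 /
    (BesselI 2 (sqrt (alpha1 k) * xk k (n - 1)) *
     BesselI 2 (sqrt (alpha1 k) * xk k (n + 1)))
  > 1 + PI ^ 4 * sqrt (alpha1 k) / (9 * xk k n ^ 3) - 1100 / xk k n ^ 4.
Proof.
  assert (hpi := PI_RGT_0); assert (hpi4 := PI_4).
  assert (hk2 : INR k <= 2) by (apply (le_INR k 2); lia).
  assert (hn2 : 2 <= INR n) by (apply (le_INR 2 n); lia).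
  (* The two values are 7/3 and 12/5. *)
  assert (halpha : 2 <= alpha1 k <= 3)
    by (destruct hk as [-> | ->]; unfold alpha1; simpl; lra).
  assert (hnm : INR (n - 1) = INR n - 1) by (rewrite minus_INR by lia; reflexivity).
  assert (hnp : INR (n + 1) = INR n + 1) by (rewrite plus_INR; reflexivity).
  assert (hsqr := xk_sqr k n ltac:(lra)).
  assert (hsqrm := xk_sqr k (n - 1) ltac:(lra)).
  assert (hsqrp := xk_sqr k (n + 1) ltac:(lra)).
  (* For m >= 1 the radicand is at least 24 - 6, so the argument at n - 1 is positive as well. *)
  assert (hxpos : forall m, 1 <= INR m -> 0 < xk k m).
  { intros m hm; unfold xk; apply Rdiv_lt_0_compat; [| lra].
    apply Rmult_lt_0_compat; [lra | apply sqrt_lt_R0; lra]. }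
  assert (hxm := hxpos (n - 1)%nat ltac:(lra)).
  assert (hxp := hxpos (n + 1)%nat ltac:(lra)).
  set (A := alpha1 k) in *; set (x := xk k n) in *.
  assert (ha : 0 < sqrt A) by (apply sqrt_lt_R0; lra).
  assert (haa : sqrt A * sqrt A = A) by (apply sqrt_sqrt; lra).
  set (a := sqrt A) in *.
  set (u := A * x ^ 2 / 4).
  set (e := PI ^ 2 * A / 6).
  rewrite !BesselI_2_series by (apply Rmult_lt_0_compat; lra).
  replace ((a * x / 2) ^ 2) with u by (unfold u; rewrite <- haa; field).
  replace ((a * xk k (n - 1) / 2) ^ 2) with (u - e).
  2:{ replace ((a * xk k (n - 1) / 2) ^ 2) with (a * a * xk k (n - 1) ^ 2 / 4) by field.
      rewrite haa, hsqrm, hnm; unfold u, e; rewrite hsqr; field. }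
  replace ((a * xk k (n + 1) / 2) ^ 2) with (u + e).
  2:{ replace ((a * xk k (n + 1) / 2) ^ 2) with (a * a * xk k (n + 1) ^ 2 / 4) by field.
      rewrite haa, hsqrp, hnp; unfold u, e; rewrite hsqr; field. }
  assert (hpi2 : 0 < PI ^ 2 <= 16) by nra.
  assert (he : 0 < e <= 8) by (unfold e; nra).
  assert (hx2 : 152 ^ 2 <= x ^ 2) by (apply pow_incr; lra).
  (* 11552 = 2 * 152^2 / 4, from alpha >= 2. With e <= 8 this is ample for u - e >= 25/16 and for
     e^2 <= u^2/2. *)
  assert (hu : 11552 <= u) by (unfold u; nra).
  apply Rlt_le_trans with (2 := bessel2_ratio_lower u e ltac:(lra) ltac:(lra)).
  replace (sqrt u) with (a * x / 2).
  2:{ symmetry; apply sqrt_lem_1; [lra | apply Rmult_le_pos; nra |].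
      unfold u; rewrite <- haa; field. }
  replace (e ^ 2 / (2 * (u * (a * x / 2)))) with (PI ^ 4 * a / (9 * x ^ 3))
    by (unfold e, u; rewrite <- haa; field; lra).
  enough (19 / 16 * (e ^ 2 / (u ^ 2 - e ^ 2)) < 1100 / x ^ 4) by lra.
  assert (hx4 : 0 < x ^ 4) by (apply pow_lt; lra).
  assert (hd : u ^ 2 / 2 <= u ^ 2 - e ^ 2) by nra.
  apply Rle_lt_trans with (19 / 16 * (e ^ 2 / (u ^ 2 / 2))).
  - apply Rmult_le_compat_l; [lra |].
    apply Rmult_le_compat_l; [nra | apply Rinv_le_contravar; nra].
  (* Alpha cancels in e/u. With pi <= 4 the numerator is at most (19/18) * 256 < 271, well below
     1100. *)
  - replace (19 / 16 * (e ^ 2 / (u ^ 2 / 2))) with (19 / 18 * (PI ^ 2) ^ 2 / x ^ 4)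
      by (unfold e, u; field; lra).
    apply Rmult_lt_compat_r; [now apply Rinv_0_lt_compat | nra].
Qed.
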